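(* Let $v^{(\ell)}_j$ ($\ell \ge 0$, $0 \le j \le 2^{\ell+1}-1$) be the rational numbers defined by $v^{(0)}_0 = 1$, $v^{(0)}_1 = 1$, and, for $\ell \ge 1$, $$v^{(\ell)}_0 = 1,\quad v^{(\ell)}_1 = 2,\quad v^{(\ell)}_{2j} = -\frac{v^{(\ell-1)}_j}{v^{(\ell)}_{2j-1}},\quad v^{(\ell)}_{2j+1} = 1 + (-1)^j - v^{(\ell)}_{2j}\qquad (1 \le j \le 2^\ell - 1).$$ For $\ell \ge 0$ let $g_\ell(z) = \frac{1}{z}\prod_{h=0}^{\ell}(1 - z^{-2^h}) \in \mathbb{Q}(z)$. Then, for every $\ell \ge 0$, $$g_\ell(z) = \cfrac{v^{(\ell)}_0}{z+1 + \cfrac{v^{(\ell)}_1}{z-1 + \cfrac{v^{(\ell)}_2}{z+1 + \cfrac{\ddots}{\ddots + \cfrac{v^{(\ell)}_{2^{\ell+1}-1}}{z-1}}}}},$$ where the $j$-th denominator (for $j = 0, 1, \ldots, 2^{\ell+1}-1$) is $z+1$ if $j$ is even and $z-1$ if $j$ is odd. Moreover, for every $\ell \ge 0$, all the partial quotients $a_i(z) \in \mathbb{Q}[z]$ in the continued fraction expansion $g_\ell(z) = [0; a_1(z), \ldots, a_m(z)] = \cfrac{1}{a_1(z) + \cfrac{1}{\ddots + \cfrac{1}{a_m(z)}}}$ are polynomials of degree one. *)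

(* Defs.v *)
From mathcomp Require Import all_boot all_order all_algebra.
Set Implicit Arguments.
Unset Strict Implicit.
Unset Printing Implicit Defensive.
Import GRing.Theory.
Local Open Scope ring_scope.

(* One level of the recursion: from [u] = (v^(l-1)_j)_j to (v^(l)_j)_j. *)
Fixpoint vnext (u : nat -> rat) (k : nat) : rat :=
  match k with
  | 0 => 1
  | 1 => 2
  | k'.+1 => if odd k then 1 + (-1) ^+ k./2 - vnext u k'
             else - (u k./2 / vnext u k')
  end.

(* [v l j] is v^(l)_j; it is meaningful only for j <= 2 ^ l.+1 - 1. *)
Fixpoint v (l : nat) : nat -> rat :=
  if l is l'.+1 then vnext (v l') else fun=> 1.

Lemma v00 : v 0 0 = 1. Proof. by []. Qed.
Lemma v01 : v 0 1 = 1. Proof. by []. Qed.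
Lemma vS0 l : v l.+1 0 = 1. Proof. by []. Qed.
Lemma vS1 l : v l.+1 1 = 2. Proof. by []. Qed.

Lemma vS_even l j : (0 < j)%N ->
  v l.+1 (2 * j)%N = - (v l j / v l.+1 (2 * j - 1)%N).
Proof.
case: j => // j _; rewrite mul2n doubleS subn1 /=.
by rewrite odd_double /= doubleK.
Qed.

Lemma vS_odd l j : (0 < j)%N ->
  v l.+1 (2 * j + 1)%N = 1 + (-1) ^+ j - v l.+1 (2 * j)%N.
Proof.
case: j => // j _; rewrite mul2n addn1 doubleS /=.
by rewrite odd_double /= uphalf_double.
Qed.

Notation Qz := {fraction {poly rat}}.

Definition Qz_const (c : rat) : Qz := tofrac c%:P.

Definition z : Qz := tofrac 'X.

Definition g (l : nat) : Qz := z^-1 * \prod_(h < l.+1) (1 - z ^- (2 ^ h)).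

(* The finite continued fraction b_0 / (c_0 + b_1 / (c_1 + ... + b_n / c_n))
   attached to the list of pairs (b_i, c_i). *)
Definition gencf (F : fieldType) (s : seq (F * F)) : F :=
  foldr (fun bc t => bc.1 / (bc.2 + t)) 0 s.

Definition den (j : nat) : Qz := if odd j then z - 1 else z + 1.

(* f = [a0; a_1, ..., a_m] with a = (a_1, ..., a_m). As usual for continued
   fractions over Q[z], the a_i with i >= 1 are required to be nonconstant;
   the expansion is then unique and no denominator vanishes in [gencf]. *)
Definition cf_expansion (f : Qz) (a0 : {poly rat}) (a : seq {poly rat}) : Prop :=
  (forall p, p \in a -> (1 < size p)%N) /\
  f = tofrac a0 + gencf [seq (1, tofrac p) | p : {poly rat} <- a].

(* Main.v *)
Require Import Defs.
From HB Require Import structures.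
From mathcomp Require Import all_boot all_order all_algebra.
From mathcomp Require Import zify ring.
Set Implicit Arguments.
Unset Strict Implicit.
Unset Printing Implicit Defensive.
Import GRing.Theory Num.Theory.
Local Open Scope ring_scope.

(** Nonvanishing: the 2-adic valuation of v^(l)_j is 1 at j = 1, -1 at j = 2^l
    and j = 2^l + 1, and 0 elsewhere (at l = 0, j = 1 the two exceptions
    cancel); this pattern reproduces itself from one level to the next.

    Identity: g_(l+1)(z) = (z - 1) g_l(z^2).  If t_j denotes the tail of the
    level l+1 fraction starting at v^(l+1)_j, and s_k the tail of the level l
    fraction in z^2 starting at v^(l)_k, then backward induction gives
    s_k = - t_(2k-1) t_(2k) for k >= 1, and then t_0 = (z - 1) s_0.

    Degrees: dividing out the nonzero constants v^(l)_j turns this fraction into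
    a regular one with linear partial quotients, and the regular expansion is
    unique because every tail has negative degree. *)

Section PadicValuation.

Variable p : nat.
Hypothesis p_prime : prime p.

Definition padic_val (e : int) (x : rat) : Prop :=
  exists m n : int,
    [/\ ~~ (p %| m)%Z, ~~ (p %| n)%Z & x = p%:R ^ e * (m%:~R / n%:~R)].

Lemma natr_prime_neq0 : p%:R != 0 :> rat.
Proof. by rewrite pnatr_eq0 -lt0n prime_gt0. Qed.

Lemma ndvdz_intr_neq0 (m : int) : ~~ (p %| m)%Z -> m%:~R != 0 :> rat.
Proof. by rewrite intr_eq0; apply: contra => /eqP->; rewrite dvdz0. Qed.

Lemma prime_dvdzM (m n : int) : (p %| m * n)%Z = (p %| m)%Z || (p %| n)%Z.
Proof. by rewrite !dvdzE abszM Euclid_dvdM. Qed.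

Lemma padic_val_neq0 e x : padic_val e x -> x != 0.
Proof.
case=> m [n [/ndvdz_intr_neq0 m0 /ndvdz_intr_neq0 n0 ->]].
by rewrite !mulf_neq0 ?invr_eq0 ?expfz_neq0 ?natr_prime_neq0.
Qed.

Lemma padic_valN e x : padic_val e x -> padic_val e (- x).
Proof.
case=> m [n [pm pn ->]]; exists (- m), n; split=> //.
  by rewrite dvdzE abszN -dvdzE.
by rewrite rmorphN mulNr mulrN.
Qed.

Lemma padic_val_div (e f : int) x y :
  padic_val e x -> padic_val f y -> padic_val (e - f) (x / y).
Proof.
case=> m [n [pm pn ->]] [m' [n' [pm' pn' ->]]].
exists (m * n'), (n * m'); rewrite !prime_dvdzM !negb_or pm pn pm' pn'.
split=> //; rewrite expfzDr ?natr_prime_neq0 // -invr_expz.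
by rewrite !rmorphM -mulf_div invf_div mulf_div.
Qed.

Lemma padic_valD_lt (e f : int) x y :
  e < f -> padic_val e x -> padic_val f y -> padic_val e (x + y).
Proof.
move=> ef; have [k ->] : exists k : nat, f = e + k.+1.
  by exists `|f - e|%N.-1; lia.
move=> [m [n [pm pn ->]]] [m' [n' [pm' pn' ->]]].
exists (m * n' + (p ^ k.+1)%:Z * (m' * n)), (n * n'); split.
- rewrite rpredDr ?prime_dvdzM ?negb_or ?pm //.
  by rewrite dvdzE /= expnS dvdn_mulr.
- by rewrite prime_dvdzM negb_or pn.
rewrite expfzDr ?natr_prime_neq0 // -mulrA -mulrDr; congr (_ * _).
have [n0 n'0] := (ndvdz_intr_neq0 pn, ndvdz_intr_neq0 pn').
rewrite rmorphD !rmorphM /= -pmulrn natrX -exprnP.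
by field; rewrite n0 n'0.
Qed.

End PadicValuation.

Lemma v0 l : v l 0 = 1.
Proof. by case: l. Qed.

Lemma v_evenE l k : v l.+1 k.*2.+2 = - (v l k.+1 / v l.+1 k.*2.+1).
Proof. by have := vS_even l (ltn0Sn k); rewrite mul2n subn1. Qed.

Lemma v_oddE l k : v l.+1 k.*2.+3 = 1 + (-1) ^+ k.+1 - v l.+1 k.*2.+2.
Proof. by have := vS_odd l (ltn0Sn k); rewrite mul2n addn1. Qed.

Lemma v_add_odd l k : v l.+1 k.*2.+2 + v l.+1 k.*2.+3 = 1 + (-1) ^+ k.+1.
Proof. by rewrite v_oddE addrC subrK. Qed.

Definition v_val2 (l j : nat) : int :=
  (j == 1)%N%:Z - (2 ^ l <= j <= (2 ^ l).+1)%N%:Z.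

Lemma v_val2_evenE l k :
  v_val2 l k.+1 - v_val2 l.+1 k.*2.+1 = v_val2 l.+1 k.*2.+2.
Proof. by rewrite /v_val2 expnS; lia. Qed.

Lemma v_val2_oddE l k : v_val2 l.+1 k.*2.+3 = v_val2 l.+1 k.*2.+2.
Proof. by rewrite /v_val2 expnS; lia. Qed.

Lemma v_val2_even_le0 l k : v_val2 l.+1 k.*2.+2 <= 0.
Proof. by rewrite /v_val2; lia. Qed.

Lemma padic_val_v_even l k :
  padic_val 2 (v_val2 l k.+1) (v l k.+1) ->
  padic_val 2 (v_val2 l.+1 k.*2.+1) (v l.+1 k.*2.+1) ->
  padic_val 2 (v_val2 l.+1 k.*2.+2) (v l.+1 k.*2.+2).
Proof.
move=> u_val v_val; rewrite v_evenE -v_val2_evenE.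
by apply: padic_valN; apply: padic_val_div.
Qed.

(* 1 + (-1)^(k+1) is 0 or 2, and v^(l+1)_(2k+2) has nonpositive valuation. *)
Lemma padic_val_v_odd l k :
  padic_val 2 (v_val2 l.+1 k.*2.+2) (v l.+1 k.*2.+2) ->
  padic_val 2 (v_val2 l.+1 k.*2.+3) (v l.+1 k.*2.+3).
Proof.
move/padic_valN => v_val; rewrite v_oddE v_val2_oddE -signr_odd.
case: (odd k.+1); first by rewrite addrN add0r.
rewrite addrC; apply: (padic_valD_lt _ (f := 1) _ v_val) => //.
  by have := v_val2_even_le0 l k; lia.
by exists 1, 1.
Qed.

Lemma padic_val_v l j : (j < 2 ^ l.+1)%N -> padic_val 2 (v_val2 l j) (v l j).
Proof.
elim: l j => [|l IHl] j; first by case: j => [|[|]] // _; exists 1, 1.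
suff pair_val k : (k < 2 ^ l.+1)%N ->
    padic_val 2 (v_val2 l.+1 k.*2) (v l.+1 k.*2) /\
    padic_val 2 (v_val2 l.+1 k.*2.+1) (v l.+1 k.*2.+1).
  rewrite -(odd_double_half j) expnS mul2n => j_lt.
  by have [|] := pair_val j./2; [lia | case: (odd j)].
elim: k => [_|k IHk k_lt].
  have pow_gt1 : (1 < 2 ^ l.+1)%N by rewrite -{1}(expn0 2) ltn_exp2l.
  have [-> ->] : v_val2 l.+1 0 = 0 /\ v_val2 l.+1 1 = 1.
    by rewrite /v_val2; lia.
  by split; exists 1, 1.
have [_ odd_val] := IHk (ltnW k_lt).
have even_val := padic_val_v_even (IHl _ k_lt) odd_val.
by split=> //; apply: padic_val_v_odd.
Qed.

Lemma v_neq0 l j : (j < 2 ^ l.+1)%N -> v l j != 0.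
Proof. by move/padic_val_v/padic_val_neq0; apply. Qed.

Lemma v_mul_even l k : (k.*2.+1 < 2 ^ l.+2)%N ->
  v l.+1 k.*2.+1 * v l.+1 k.*2.+2 = - v l k.+1.
Proof. by move=> k_lt; rewrite v_evenE mulrN mulrC divfK ?v_neq0. Qed.

Lemma size_gt_neq0 (R : nzSemiRingType) n (p : {poly R}) :
  (n < size p)%N -> p != 0.
Proof. by rewrite -size_poly_gt0; apply: leq_ltn_trans. Qed.

Lemma size_polyD_sign (R : nzRingType) (p : {poly R}) j :
  (1 < size p)%N -> size (p + (-1) ^+ j) = size p.
Proof.
move=> p_gt1; rewrite size_polyDl //.
by rewrite -[_ ^+ j]mulr1 size_Msign size_poly1.
Qed.

Lemma ltn_size_mul2r (R : idomainType) (p q r : {poly R}) :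
  r != 0 -> (size p < size q)%N -> (size (p * r)%R < size (q * r)%R)%N.
Proof.
move=> r0 pq; have q0 := size_gt_neq0 pq.
have [->|p0] := eqVneq p 0.
  by rewrite mul0r size_poly0 size_poly_gt0 mulf_neq0.
by rewrite !size_mul //; rewrite -size_poly_gt0 in p0; lia.
Qed.

Lemma ltn_size_mull (R : idomainType) (p q : {poly R}) :
  q != 0 -> (1 < size p)%N -> (size q < size (p * q)%R)%N.
Proof.
by move=> q0 p_gt1; rewrite -{1}[q]mul1r ltn_size_mul2r // size_poly1.
Qed.

Section ProperFraction.

Variable R : idomainType.
Implicit Types (p q : {poly R}) (x y : {fraction {poly R}}).

Definition proper_fraction x : Prop :=
  exists n d : {poly R}, (size n < size d)%N /\ x = tofrac n / tofrac d.

Lemma proper_fraction0 : proper_fraction 0.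
Proof. by exists 0, 1; rewrite size_poly0 size_poly1 tofrac0 mul0r. Qed.

Lemma proper_fractionB x y :
  proper_fraction x -> proper_fraction y -> proper_fraction (x - y).
Proof.
move=> [n [d [nd ->]]] [n' [d' [nd' ->]]].
have [d0 d'0] := (size_gt_neq0 nd, size_gt_neq0 nd').
exists (n * d' - n' * d), (d * d'); split; last first.
  by rewrite -mulNr addf_div ?tofrac_eq0 // mulNr tofracB !tofracM.
apply: leq_ltn_trans (size_polyD _ _) _; rewrite size_polyN gtn_max.
by rewrite ltn_size_mul2r //= [d * d']mulrC ltn_size_mul2r.
Qed.

Lemma proper_fraction_tofrac p : proper_fraction (tofrac p) -> p = 0.
Proof.
move=> [n [d [nd pE]]]; have d0 := size_gt_neq0 nd.
have nE : n = p * d.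
  by apply/eqP; rewrite -tofrac_eq tofracM pE mulfVK // tofrac_eq0.
apply/eqP; apply: contraTT nd => p0; rewrite nE -leqNgt size_mul //.
by rewrite -size_poly_gt0 in p0; lia.
Qed.

Lemma tofracD_proper_inj p q x y :
    proper_fraction x -> proper_fraction y ->
  tofrac p + x = tofrac q + y -> p = q /\ x = y.
Proof.
move=> x_proper y_proper pxqy.
have pq : p = q.
  apply/eqP; rewrite -subr_eq0; apply/eqP/proper_fraction_tofrac.
  have -> : tofrac (p - q) = y - x.
    by apply/eqP; rewrite tofracB subr_eq addrAC eq_sym subr_eq pxqy addrC.
  exact: proper_fractionB.
by split=> //; move: pxqy; rewrite pq => /addrI.
Qed.

Lemma tofracD_proper_neq0 p x :
  p != 0 -> proper_fraction x -> tofrac p + x != 0.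
Proof.
move=> p0 x_proper; apply: contra_neq p0 => px0.
have [] // := @tofracD_proper_inj p 0 x 0 x_proper proper_fraction0.
by rewrite px0 tofrac0 addr0.
Qed.

Lemma proper_fraction_divD b p x :
    (1 < size p)%N -> proper_fraction x ->
  proper_fraction (tofrac b%:P / (tofrac p + x)).
Proof.
move=> p_gt1 [n [d [nd ->]]]; have d0 := size_gt_neq0 nd.
exists (b%:P * d), (p * d + n); split; last first.
  have fd0 : tofrac d != 0 by rewrite tofrac_eq0.
  by rewrite tofracD !tofracM -{1}(mulfK fd0 (tofrac p)) -mulrDl invf_div mulrA.
have d_lt := ltn_size_mull d0 p_gt1.
rewrite size_polyDl ?(ltn_trans nd) //.
by rewrite mul_polyC (leq_ltn_trans (size_scale_leq _ _)).
Qed.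

End ProperFraction.

Section PolyContinuedFraction.

Variable R : idomainType.
Implicit Types (s : seq (R * {poly R})) (a : seq {poly R}).

Definition poly_gencf s : {fraction {poly R}} :=
  gencf [seq (tofrac bp.1%:P, tofrac bp.2) | bp <- s].

Definition nonconstant a : Prop := {in a, forall p : {poly R}, (1 < size p)%N}.

Definition regular_gencf a : {fraction {poly R}} :=
  gencf [seq (1, tofrac p) | p : {poly R} <- a].

Lemma poly_gencf_cons b p s :
  poly_gencf ((b, p) :: s) = tofrac b%:P / (tofrac p + poly_gencf s).
Proof. by []. Qed.

Lemma regular_gencf_cons p a :
  regular_gencf (p :: a) = (tofrac p + regular_gencf a)^-1.
Proof. by rewrite -[RHS]mul1r. Qed.

Lemma regular_gencfE a : regular_gencf a = poly_gencf [seq (1, p) | p <- a].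
Proof. by rewrite /poly_gencf -map_comp. Qed.

Lemma proper_poly_gencf s :
  {in s, forall bp : R * {poly R}, (1 < size bp.2)%N} ->
  proper_fraction (poly_gencf s).
Proof.
elim: s => [|[b p] s IHs] s_gt1; first exact: proper_fraction0.
case/forall_cons: s_gt1 => p_gt1 s_gt1.
exact: proper_fraction_divD p_gt1 (IHs s_gt1).
Qed.

Lemma proper_regular_gencf a :
  nonconstant a -> proper_fraction (regular_gencf a).
Proof.
move=> a_gt1; rewrite regular_gencfE; apply: proper_poly_gencf.
by move=> _ /mapP[p p_a ->]; apply: a_gt1.
Qed.

Lemma regular_gencf_cons_neq0 p a :
  nonconstant (p :: a) -> regular_gencf (p :: a) != 0.
Proof.
case/forall_cons => p_gt1 a_gt1; rewrite regular_gencf_cons invr_eq0.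
exact: tofracD_proper_neq0 (size_gt_neq0 p_gt1) (proper_regular_gencf a_gt1).
Qed.

Lemma regular_gencf_inj a a' :
    nonconstant a -> nonconstant a' ->
  regular_gencf a = regular_gencf a' -> a = a'.
Proof.
elim: a a' => [|p a IHa] [|q a'] // a_gt1 a'_gt1.
- by move/esym/eqP; rewrite (negPf (regular_gencf_cons_neq0 a'_gt1)).
- by move/eqP; rewrite (negPf (regular_gencf_cons_neq0 a_gt1)).
case/forall_cons: a_gt1 => _ a_gt1; case/forall_cons: a'_gt1 => _ a'_gt1.
rewrite !regular_gencf_cons => /invr_inj/tofracD_proper_inj.
by case=> [||-> /IHa -> //]; apply: proper_regular_gencf.
Qed.

End PolyContinuedFraction.

Section Regularization.

Variable F : fieldType.
Implicit Types (c : F) (s : seq (F * {poly F})).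

Fixpoint regularize c s : seq {poly F} :=
  if s is (b, p) :: s' then
    (c * b)^-1 *: p :: regularize (c * b)^-1 s'
  else [::].

Lemma regular_gencf_regularize c s :
  regular_gencf (regularize c s) = tofrac c%:P * poly_gencf s.
Proof.
elim: s c => [|[b p] s IHs] c; first by rewrite mulr0.
rewrite /= regular_gencf_cons poly_gencf_cons IHs -mul_polyC tofracM -mulrDr.
rewrite -[tofrac _^-1%:P]/((@tofrac _ \o polyC) _) fmorphV /=.
by rewrite polyCM tofracM invfM invrK mulrA.
Qed.

Lemma size_regularize c s n :
    c != 0 -> {in s, forall bp : F * {poly F}, bp.1 != 0} ->
    {in s, forall bp : F * {poly F}, size bp.2 = n} ->
  {in regularize c s, forall p : {poly F}, size p = n}.
Proof.
elim: s c => [|[b p] s IHs] c c0 //.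
case/forall_cons=> /= b0 s0 /forall_cons[/= p_n s_n].
have cb0 : (c * b)^-1 != 0 by rewrite invr_eq0 mulf_neq0.
by apply/forall_cons; split; [rewrite size_scale | apply: IHs].
Qed.

End Regularization.

(* For tails t0, t1, t2 of the fraction, multiplied by their denominators, the
   hypothesis says v_(2k) + v_(2k+1) = 1 + (-1)^k, with e = (-1)^k. *)
Lemma contraction_factor (R : comPzRingType) (x e t0 t1 t2 : R) :
    t0 * (x + 1 + t1) + t1 * (x - 1 + t2) = 1 + e ->
  x ^+ 2 + e - t1 * t2 = (x - 1 + t0) * (x + 1 + t1).
Proof.
move=> sum_eq; have -> : e = 1 + e - 1 by ring.
by rewrite -sum_eq; ring.
Qed.

Lemma two_term_fraction (F : fieldType) (x : F) :
  x != 0 -> x - 1 != 0 -> x^-1 * (1 - x^-1) = 1 / (x + 1 + 1 / (x - 1)).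
Proof.
move=> x0 x1; have -> : x + 1 + 1 / (x - 1) = x ^+ 2 / (x - 1) by field.
by field; rewrite x0 x1.
Qed.

Lemma invf_mul_subV (F : fieldType) (x : F) :
  x^-1 * (1 - x^-1) = (x - 1) / x ^+ 2.
Proof.
by have [->|x0] := eqVneq x 0; [rewrite expr0n /= invr0 mul0r mulr0 | field].
Qed.

HB.instance Definition _ := GRing.RMorphism.copy Qz_const (@tofrac _ \o polyC).

Lemma denE j : den j = z + (-1) ^+ j.
Proof. by rewrite /den -signr_odd; case: (odd j). Qed.

Section Tail.

Implicit Types (l j k n : nat) (p : {poly rat}).

(* Taking an arbitrary polynomial p in place of z turns the substitution of z^2
   for z into p ^+ 2 for p. *)
Definition tail_terms l p j n : seq (rat * {poly rat}) :=
  [seq (v l i, p + (-1) ^+ i) | i <- iota j n].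

Lemma tail_terms_neq0 l p j n : (j + n <= 2 ^ l.+1)%N ->
  {in tail_terms l p j n, forall bp : rat * {poly rat}, bp.1 != 0}.
Proof.
move=> jn_le bp /mapP[i]; rewrite mem_iota => /andP[_ i_lt] ->.
by rewrite v_neq0 ?(leq_trans i_lt).
Qed.

Lemma size_tail_terms l p j n : (1 < size p)%N ->
  {in tail_terms l p j n, forall bp : rat * {poly rat}, size bp.2 = size p}.
Proof. by move=> p_gt1 bp /mapP[i _ ->]; rewrite size_polyD_sign. Qed.

Definition tail l p j n : Qz := poly_gencf (tail_terms l p j n).

Lemma tailX l n :
  tail l 'X 0 n = gencf (mkseq (fun j => (Qz_const (v l j), den j)) n).
Proof.
rewrite /tail /poly_gencf -map_comp; congr gencf; apply: eq_map => j /=.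
by rewrite denE tofracD rmorph_sign.
Qed.

Lemma tailS l p j n :
  tail l p j n.+1 =
    Qz_const (v l j) / (tofrac p + (-1) ^+ j + tail l p j.+1 n).
Proof. by rewrite /tail /= poly_gencf_cons tofracD rmorph_sign. Qed.

Lemma proper_tail l p j n : (1 < size p)%N -> proper_fraction (tail l p j n).
Proof.
by move=> p_gt1; apply: proper_poly_gencf => bp /size_tail_terms->.
Qed.

Lemma den_tail_neq0 l p i j n :
  (1 < size p)%N -> tofrac p + (-1) ^+ i + tail l p j n != 0.
Proof.
move=> p_gt1; rewrite -(rmorph_sign (@tofrac _)) -tofracD.
apply: tofracD_proper_neq0; last exact: proper_tail.
by apply: (@size_gt_neq0 _ 1); rewrite size_polyD_sign.
Qed.

Lemma tofrac_sub1_neq0 p : (1 < size p)%N -> tofrac p - 1 != 0.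
Proof. by move/(den_tail_neq0 0 1 0 0); rewrite addr0. Qed.

Lemma tailS_mul_den l p j n : (1 < size p)%N ->
  tail l p j n.+1 * (tofrac p + (-1) ^+ j + tail l p j.+1 n) = Qz_const (v l j).
Proof. by move=> p_gt1; rewrite tailS mulfVK ?den_tail_neq0. Qed.

Lemma tail_even_mul_den l p k n : (1 < size p)%N ->
  tail l p k.*2 n.+1 * (tofrac p + 1 + tail l p k.*2.+1 n) =
    Qz_const (v l k.*2).
Proof. by move/(tailS_mul_den l k.*2 n); rewrite -signr_odd odd_double. Qed.

Lemma tail_odd_mul_den l p k n : (1 < size p)%N ->
  tail l p k.*2.+1 n.+1 * (tofrac p - 1 + tail l p k.*2.+2 n) =
    Qz_const (v l k.*2.+1).
Proof.
by move/(tailS_mul_den l k.*2.+1 n); rewrite -signr_odd oddS odd_double.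
Qed.

Lemma tail_contraction l p k n :
    (1 < size p)%N -> (k + n < 2 ^ l.+1)%N ->
  tail l (p ^+ 2) k.+1 n =
    - (tail l.+1 p k.*2.+1 n.*2.+1 * tail l.+1 p k.*2.+2 n.*2).
Proof.
move=> p_gt1; elim: n k => [|n IHn] k kn_lt; first by rewrite mulr0 oppr0.
rewrite tailS IHn ?addSnnS // doubleS tofracXn.
set x := tofrac p; set t1 := tail l.+1 p k.+1.*2.+1 _.
set t2 := tail l.+1 p k.+1.*2.+2 _; set t0 := tail l.+1 p k.*2.+2 _.
have t0_mul : t0 * (x + 1 + t1) = Qz_const (v l.+1 k.*2.+2).
  exact: (tail_even_mul_den l.+1 k.+1).
have t1_mul : t1 * (x - 1 + t2) = Qz_const (v l.+1 k.*2.+3).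
  exact: (tail_odd_mul_den l.+1 k.+1).
rewrite (contraction_factor (t0 := t0)); last first.
  by rewrite t0_mul t1_mul -rmorphD v_add_odd rmorphD rmorph1 rmorph_sign.
have odd_den_neq0 : x - 1 + t0 != 0 by apply: (den_tail_neq0 l.+1 1).
have even_den_neq0 : x + 1 + t1 != 0 by apply: (den_tail_neq0 l.+1 0).
apply: (canLR (mulfK (mulf_neq0 odd_den_neq0 even_den_neq0))).
rewrite mulNr mulrACA t0_mul tail_odd_mul_den // -rmorphM v_mul_even.
  by rewrite rmorphN opprK.
by rewrite expnS; lia.
Qed.

Lemma tail_double l p : (1 < size p)%N ->
  tail l.+1 p 0 (2 ^ l.+2) = (tofrac p - 1) * tail l (p ^+ 2) 0 (2 ^ l.+1).
Proof.
move=> p_gt1; rewrite [(2 ^ l.+2)%N]expnS mul2n.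
have [n powE] : exists n, (2 ^ l.+1 = n.+1)%N.
  by exists (2 ^ l.+1).-1; rewrite prednK ?expn_gt0.
rewrite powE doubleS [LHS]tailS [tail l _ 0 _]tailS tail_contraction ?powE //.
rewrite !v0 !rmorph1 !div1r.
set t1 := tail l.+1 p 1 _; set t2 := tail l.+1 p 2 _.
have t1_mul : t1 * (tofrac p - 1 + t2) = 1 + 1.
  by rewrite [LHS](tail_odd_mul_den l.+1 0) // rmorphD rmorph1.
rewrite tofracXn (contraction_factor (t0 := 0)) ?mul0r ?add0r // addr0.
by rewrite invfM mulVKf ?tofrac_sub1_neq0.
Qed.

Lemma product_eq_tail l p : (1 < size p)%N ->
  (tofrac p)^-1 * \prod_(h < l.+1) (1 - tofrac p ^- (2 ^ h)) =
    tail l p 0 (2 ^ l.+1).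
Proof.
elim: l p => [|l IHl] p p_gt1.
  have x0 : tofrac p != 0 by rewrite tofrac_eq0 (size_gt_neq0 p_gt1).
  have x1 := tofrac_sub1_neq0 p_gt1.
  rewrite big_ord1 expr1 [RHS]tailS tailS addr0 !(rmorph1 Qz_const).
  exact: (two_term_fraction x0 x1).
have sqr_gt1 : (1 < size (p ^+ 2)%R)%N.
  by rewrite expr2 (ltn_trans p_gt1) ?ltn_size_mull ?(size_gt_neq0 p_gt1).
rewrite tail_double // -IHl // big_ord_recl expr1 tofracXn mulrA.
under eq_bigr => i _ do rewrite lift0 expnS exprM.
by rewrite mulrA invf_mul_subV.
Qed.

Lemma g_eq_tail l : g l = tail l 'X 0 (2 ^ l.+1).
Proof. by rewrite -product_eq_tail ?size_polyX. Qed.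

Definition g_quotients l : seq {poly rat} :=
  regularize 1 (tail_terms l 'X 0 (2 ^ l.+1)).

Lemma regular_gencf_g_quotients l : regular_gencf (g_quotients l) = g l.
Proof. by rewrite regular_gencf_regularize rmorph1 mul1r g_eq_tail. Qed.

Lemma size_g_quotients l :
  {in g_quotients l, forall p : {poly rat}, size p = 2%N}.
Proof.
apply: size_regularize; rewrite ?oner_neq0 //; first exact: tail_terms_neq0.
by move=> bp /size_tail_terms->; rewrite size_polyX.
Qed.

End Tail.

Theorem theorem2p2 (l : nat) :
  [/\ (* the recursion defining v^(l) never divides by zero *)
      (forall j : nat, (1 <= j <= 2 ^ l - 1)%N -> v l (2 * j - 1) != 0),
      g l = gencf (mkseq (fun j => (Qz_const (v l j), den j)) (2 ^ l.+1)),
      (exists a : seq {poly rat}, cf_expansion (g l) 0 a)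
    & (forall a : seq {poly rat}, cf_expansion (g l) 0 a ->
        forall p, p \in a -> size p = 2%N)].
Proof.
have g_quotients_gt1 : nonconstant (g_quotients l).
  by move=> p /size_g_quotients->.
split.
- by move=> j j_lt; apply: v_neq0; rewrite expnS; lia.
- by rewrite g_eq_tail tailX.
- exists (g_quotients l); split=> //.
  by rewrite tofrac0 add0r -regular_gencf_g_quotients.
move=> a [a_gt1]; rewrite tofrac0 add0r -regular_gencf_g_quotients.
by move/regular_gencf_inj => <- //; apply: size_g_quotients.
Qed.
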